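(* Let $V$ be a real vector space of finite dimension $n>0$, let $p,p'\ge0$ be integers with $p+p'=n$, and let $\Gamma$ be the manifold of all scalar products of signature $(p,p')$ on $V$. For a basis $(v_i)$ of $V$ let $\gamma_{ij}:\Gamma\to\mathbb{R}$ be the functions $\gamma_{ij}(\gamma)=\gamma(v_i,v_j)$, let $(\gamma^{ij})$ be the functions on $\Gamma$ with $\gamma^{ik}\gamma_{kj}=\delta^i{}_j$, and put $$Q:=\gamma^{ik}\gamma^{jl}\,d\gamma_{ij}\otimes d\gamma_{kl}.$$ Then the tensor field $Q$ does not depend on the choice of the basis $(v_i)$; $Q$ is a metric (symmetric and non-degenerate at every point) on $\Gamma$ of signature $$\Big(\frac{p(p+1)+p'(p'+1)}{2},\;pp'\Big);$$ and $Q$ is invariant under the action of $GL(V)$, i.e. $\bar g^\star Q=Q$ for every $g\in GL(V)$.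
   Context: A scalar product on $V$ is a non-degenerate symmetric bilinear form on $V$; its signature is $(p,p')$ if an orthonormal basis has $p$ vectors of square $+1$ and $p'$ of square $-1$. $\Gamma$ is an open subset of the $n(n+1)/2$-dimensional vector space of symmetric bilinear forms on $V$, hence a real-analytic manifold, with global coordinates $(\gamma_{ij})_{i\le j}$ for each basis of $V$. $GL(V)$ acts on $\Gamma$ by $\bar g(\gamma)=(g^{-1})^*\gamma$, i.e. $(\bar g\gamma)(v,v')=\gamma(g^{-1}v,g^{-1}v')$; $\bar g^\star$ denotes pull-back of tensor fields by the diffeomorphism $\bar g:\Gamma\to\Gamma$. Summation over all values $1,\dots,n$ of repeated indices is understood. The signature of a metric lists the number of positive, then negative, squares. *)

(* Defs.v *)
From HB Require Import structures.
From mathcomp Require Import all_boot all_order all_algebra.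
From mathcomp Require Import all_classical all_reals all_analysis.

Set Implicit Arguments.
Unset Strict Implicit.
Unset Printing Implicit Defensive.

Import Order.TTheory GRing.Theory Num.Theory.
Import numFieldNormedType.Exports.

Local Open Scope classical_set_scope.
Local Open Scope ring_scope.

(* A bilinear form on V is an element b of 'Hom(V, 'Hom(V, R^o)), with value  *)
(* b x y at (x, y). The symmetric ones form the kernel of b |-> b - flip b.   *)
Definition flip_form (R : realType) (V : vectType R)
    (b : 'Hom(V, 'Hom(V, R^o))) : 'Hom(V, 'Hom(V, R^o)) :=
  linfun (fun x => linfun (fun y => b y x)).

Definition sym_space (R : realType) (V : vectType R) :
    {vspace 'Hom(V, 'Hom(V, R^o))} :=
  lker (linfun (fun b : 'Hom(V, 'Hom(V, R^o)) => b - flip_form b)).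

Definition sym_form (R : realType) (V : vectType R) : Type :=
  subvs_of (sym_space V).

HB.instance Definition _ (R : realType) (V : vectType R) :=
  Vector.on (sym_form V).

Definition sym_form_app (R : realType) (V : vectType R) (b : sym_form V)
  (x y : V) : R := vsval b x y.

Coercion sym_form_app : sym_form >-> Funclass.

(* Meaningful when b is bilinear and symmetric, see mk_sym_formE. *)
Definition mk_sym_form (R : realType) (V : vectType R) (b : V -> V -> R) :
    sym_form V :=
  vsproj (sym_space V) (linfun (fun x => linfun (b x : V -> R^o))).

Lemma linfunE_linear (R : realType) (U W : vectType R) (f : U -> W) :
  linear f -> linfun f =1 f.
Proof.
move=> lf x.
pose l := HB.pack f (GRing.isLinear.Build R U W _ _ lf) : {linear U -> W}.
by rewrite -[LHS]/(linfun l x) lfunE.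
Qed.

Lemma hom2E (R : realType) (V : vectType R) (b : V -> V -> R^o) :
  (forall y, linear (b^~ y)) -> (forall x, linear (b x)) ->
  forall x y, linfun (fun x => linfun (b x)) x y = b x y.
Proof.
move=> bl br x y; rewrite linfunE_linear ?linfunE_linear // => a u v.
apply/lfunP => w; rewrite add_lfunE scale_lfunE !linfunE_linear //.
exact: bl.
Qed.

Lemma flip_formE (R : realType) (V : vectType R)
  (b : 'Hom(V, 'Hom(V, R^o))) x y : flip_form b x y = b y x.
Proof.
rewrite /flip_form (@hom2E _ _ (fun x y => b y x)) // => z a u v.
  by rewrite linearP.
by rewrite linearP add_lfunE scale_lfunE.
Qed.

Lemma sym_spaceP (R : realType) (V : vectType R)
  (b : 'Hom(V, 'Hom(V, R^o))) :
  b \in sym_space V <-> forall x y, b x y = b y x.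
Proof.
rewrite memv_ker linfunE_linear => [|a u v]; last first.
  apply/lfunP => x; apply/lfunP => y.
  rewrite !(add_lfunE, scale_lfunE, opp_lfunE, flip_formE) scalerBr.
  by rewrite opprD addrACA.
rewrite subr_eq0; split=> [/eqP bE x y|bC]; first by rewrite {1}bE flip_formE.
by apply/eqP/lfunP => x; apply/lfunP => y; rewrite flip_formE bC.
Qed.

Section SymFormTheory.
Context {R : realType} {V : vectType R}.
Implicit Types b c : sym_form V.

Lemma sym_formC b x y : b x y = b y x.
Proof. by apply: (sym_spaceP (vsval b)).1; apply: subvsP. Qed.

Lemma sym_form_linearr b x : linear (b x : V -> R^o).
Proof. by move=> a u v; rewrite /sym_form_app linearP. Qed.

Lemma sym_form_linearl b y : linear (b^~ y : V -> R^o).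
Proof. by move=> a u v /=; rewrite ![b _ y]sym_formC sym_form_linearr. Qed.

Lemma sym_formP b c : (forall x y, b x y = c x y) -> b = c.
Proof.
by move=> bc; apply/val_inj/lfunP => x; apply/lfunP => y; apply: bc.
Qed.

Lemma sym_formDE b c x y : (b + c : sym_form V) x y = b x y + c x y.
Proof. by rewrite /sym_form_app !add_lfunE. Qed.

Lemma sym_formZE a b x y : (a *: b : sym_form V) x y = a * b x y.
Proof. by rewrite /sym_form_app !scale_lfunE. Qed.

Lemma mk_sym_formE (b : V -> V -> R) :
  (forall x, linear (b x : V -> R^o)) -> (forall x y, b x y = b y x) ->
  forall x y, mk_sym_form b x y = b x y.
Proof.
move=> br bC.
have bl y : linear (b^~ y : V -> R^o).
  by move=> a u v; rewrite ![b _ y]bC br.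
have E x y : linfun (fun x => linfun (b x : V -> R^o)) x y = b x y.
  exact: hom2E.
move=> x y; rewrite /sym_form_app /mk_sym_form vsprojK ?E //.
by apply/sym_spaceP => u v; rewrite !E.
Qed.

(* The vector space of symmetric bilinear forms is finite-dimensional, so     *)
(* that any norm gives its topology and its differential calculus.            *)
Definition sym_form_norm (b : sym_form V) : R :=
  \sum_i `|coord (vbasis {: sym_form V}) i b|.

Lemma sym_form_normD b c :
  sym_form_norm (b + c) <= sym_form_norm b + sym_form_norm c.
Proof.
by rewrite -big_split ler_sum // => i _; rewrite raddfD ler_normD.
Qed.

Lemma sym_form_normZ (a : R) b :
  sym_form_norm (a *: b) = `|a| * sym_form_norm b.
Proof. by rewrite mulr_sumr; apply: eq_bigr => i _; rewrite linearZ normrM. Qed.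

Lemma sym_form_norm0_eq0 b : sym_form_norm b = 0 -> b = 0.
Proof.
move/eqP; rewrite psumr_eq0 // => /allP b0.
rewrite [b](coord_vbasis (memvf b)); apply: big1 => i _.
have /(_ (mem_index_enum _)) := b0 i.
by rewrite normr_eq0 => /eqP->; rewrite scale0r.
Qed.

End SymFormTheory.

HB.instance Definition _ (R : realType) (V : vectType R) :=
  @Lmodule_isNormed.Build R (sym_form V) (@sym_form_norm R V)
    sym_form_normD sym_form_normZ sym_form_norm0_eq0.

Definition scalar_product (R : realType) (W : vectType R) (b : W -> W -> R) :
    Prop :=
  [/\ forall x, scalar (b x),
      forall x y, b x y = b y x
    & forall x, (forall y, b x y = 0) -> x = 0].

Definition orthonormal_basis (R : realType) (W : vectType R)
    (b : W -> W -> R) (X : seq W) : Prop :=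
  [/\ basis_of {:W} X,
      {in X &, forall x y, x != y -> b x y = 0}
    & {in X, forall x, b x x = 1 \/ b x x = -1}].

Definition has_signature (R : realType) (W : vectType R) (b : W -> W -> R)
    (p q : nat) : Prop :=
  exists X : seq W, [/\ orthonormal_basis b X,
    count (fun x => b x x == 1) X = p & count (fun x => b x x == -1) X = q].

(* The manifold Gamma, an open subset of the space sym_form V; the tangent    *)
(* space at each of its points is thus sym_form V. Tensor fields on Gamma are *)
(* given by functions on sym_form V whose values outside of Gamma are         *)
(* irrelevant.                                                                *)
Definition scalar_products (R : realType) (V : vectType R) (p p' : nat) :
    set (sym_form V) :=
  [set b : sym_form V | scalar_product b /\ has_signature b p p'].

(* C^oo on an open set A: all iterated directional derivatives are (Frechet)  *)
(* differentiable on A.                                                       *)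
Definition smooth_on (R : realType) (E : normedModType R) (A : set E)
    (f : E -> R) : Prop :=
  forall (s : seq E) (x : E), A x ->
    differentiable (foldr (fun v g => 'D_v g) f s) x.

Definition metric_on (R : realType) (V : vectType R) (A : set (sym_form V))
    (T : sym_form V -> sym_form V -> sym_form V -> R) : Prop :=
  (forall h k, smooth_on A (fun b => T b h k)) /\
  (forall b, A b -> scalar_product (T b)).

Section Q.
Context {R : realType} {V : vectType R} {n : nat} (X : n.-tuple V).

Definition gam (i j : 'I_n) (b : sym_form V) : R := b X`_i X`_j.

Definition gam_inv (i j : 'I_n) (b : sym_form V) : R :=
  invmx (\matrix_(k, l) gam k l b) i j.

(* (gamma^ik gamma^jl dgamma_ij (x) dgamma_kl)_b (h, h') *)
Definition Qfield (b h h' : sym_form V) : R :=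
  \sum_i \sum_j \sum_k \sum_l
    gam_inv i k b * gam_inv j l b * ('d (gam i j) b h * 'd (gam k l) b h').

Lemma gam_invP (b : sym_form V) : basis_of {:V} X -> scalar_product b ->
  forall i j, \sum_k gam_inv i k b * gam k j b = (i == j)%:R.
Proof.
move=> bX [_ _ ndb] i j.
set M := \matrix_(k, l) gam k l b.
have Mu : M \in unitmx.
  rewrite -row_free_unit -kermx_eq0; apply/rowV0P => u /sub_kermxP uM.
  pose x := \sum_(k < n) u 0 k *: X`_k.
  have bxE y : b x y = \sum_(k < n) u 0 k * b X`_k y.
    rewrite /x /sym_form_app linear_sum sum_lfunE; apply: eq_bigr => k _.
    by rewrite linearZ scale_lfunE.
  have bxX (j' : 'I_n) : b x X`_j' = 0.
    rewrite bxE; move/rowP: uM => /(_ j'); rewrite !mxE => uM.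
    by rewrite -[RHS]uM; apply: eq_bigr => k _; rewrite mxE.
  have x0 : x = 0.
    apply: ndb => y; rewrite (coord_basis bX (memvf y)).
    rewrite {1}/sym_form_app linear_sum; apply: big1 => j' _.
    rewrite linearZ /=; have := bxX j'; rewrite /sym_form_app => ->.
    by rewrite scaler0.
  apply/rowP => k; rewrite mxE.
  by have /freeP/(_ (fun k => u 0 k) x0 k) := basis_free bX.
have := mulVmx Mu => /matrixP/(_ i j).
rewrite !mxE => <-; apply: eq_bigr => k _.
by rewrite /gam_inv !mxE.
Qed.

End Q.

Definition GL_act (R : realType) (V : vectType R) (g : 'End(V))
    (b : sym_form V) : sym_form V :=
  mk_sym_form (fun v w => b (g^-1%VF v) (g^-1%VF w)).

Lemma GL_actE (R : realType) (V : vectType R) (g : 'End(V)) (b : sym_form V)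
  v w : GL_act g b v w = b (g^-1%VF v) (g^-1%VF w).
Proof.
rewrite mk_sym_formE // => [x a u y|x y]; last exact: sym_formC.
by rewrite linearP sym_form_linearr.
Qed.

Lemma GL_act_scalar_products (R : realType) (V : vectType R) (p p' : nat)
  (g : 'End(V)) (b : sym_form V) :
  lker g == 0%VS -> scalar_products p p' b -> scalar_products p p' (GL_act g b).
Proof.
move=> g0 [[blin bC bnd] [Y [[Ybas Yo Y1] Yp Yp']]].
have gK : cancel g g^-1%VF.
  by move=> v; rewrite -comp_lfunE lker0_compVf // id_lfunE.
have gKV : cancel g^-1%VF g.
  by move=> v; rewrite -comp_lfunE lker0_compfV // id_lfunE.
have gE x y : GL_act g b (g x) (g y) = b x y by rewrite GL_actE !gK.
split.
  split=> [x|x y|x xnd].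
  - exact: sym_form_linearr.
  - exact: sym_formC.
  - rewrite -[x]gKV (bnd (g^-1%VF x)) ?linear0 // => y.
    by rewrite -gE gKV.
exists (map g Y); split; last 2 first.
- by rewrite count_map -[RHS]Yp; apply: eq_count => x /=; rewrite gE.
- by rewrite count_map -[RHS]Yp'; apply: eq_count => x /=; rewrite gE.
split.
- have -> : {:V}%VS = (g @: {:V})%VS by rewrite lker0_limgf.
  by apply: limg_basis_of => //; rewrite (eqP g0) capv0.
- move=> _ _ /mapP[x xY ->] /mapP[y yY ->]; rewrite gE => gxy.
  by apply: Yo => //; apply: contraNneq gxy => ->.
- by move=> _ /mapP[x xY ->]; rewrite gE; apply: Y1.
Qed.

Definition pullback (R : realType) (E F : normedModType R) (f : E -> F)
    (T : F -> F -> F -> R) (b h k : E) : R :=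
  T (f b) ('d f b h) ('d f b k).

(* Main.v *)
Require Import Defs.
From HB Require Import structures.
From mathcomp Require Import all_boot all_order all_algebra.
From mathcomp Require Import all_classical all_reals all_analysis.
From mathcomp Require Import perm ring zify.

(** In a basis, Q_b(h, h') = tr(B^-1 H B^-1 H'), where B, H, H' are the Gram
    matrices; a change of basis multiplies them by P and P^T, which the trace
    does not see. Acting by g on b, h, h' amounts to moving the basis by g^-1.
    In a basis orthonormal for b with signs eps_i,
    Q_b(h, h') = \sum_(i, j) eps_i eps_j h_ij h'_ij, which is diagonal in the
    coordinates h_ij, i <= j, with sign eps_i eps_j.
    For smoothness, the entries of B^-1 are built from linear forms by ring
    operations and inverses of nonvanishing functions, a class of functions
    stable under directional derivatives. *)

Set Implicit Arguments.
Unset Strict Implicit.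
Unset Printing Implicit Defensive.

Import Order.TTheory GRing.Theory Num.Theory.
Import numFieldNormedType.Exports.

Local Open Scope classical_set_scope.
Local Open Scope ring_scope.

(** * Smoothness of rational functions on an open set *)

Section Calculus.
Context {R : realType}.

(** The first-order expansion of [g] at [x] serves for [f], since a little-o at 0 only sees values
    near [x]. This lets a closed formula, valid on an open set, stand in for an iterated
    derivative. *)
Lemma near_eq_differentiable (E F : normedModType R) (f g : E -> F) (x : E) :
  {near x, g =1 f} -> differentiable g x -> differentiable f x.
Proof.
move=> gf dg.
have fE : f \o shift x = cst (f x) + 'd g x +o_ 0 id.
  apply/eqaddoP => e e0.
  have /eqaddoP/(_ e e0) := diff_locally dg.
  have gf0 : \forall h \near 0, g (h + x) = f (h + x).
    move/nbhs0P: (gf : \forall y \near x, g y = f y); apply: filterS => h.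
    by rewrite addrC.
  move=> H; near=> h.
  have -> : (f \o shift x - (cst (f x) + 'd g x)) h =
            (g \o shift x - (cst (g x) + 'd g x)) h.
    rewrite -![LHS]/(f (h + x) - (f x + 'd g x h)).
    rewrite -![RHS]/(g (h + x) - (g x + 'd g x h)).
    by rewrite (nbhs_singleton gf); congr (_ - _); near: h; move: gf0; apply: filterS.
  by near: h.
have dgc : continuous ('d g x) by case/diff_locallyP: dg.
apply/diff_locallyP; rewrite (diff_unique dgc fE); split => //.
Unshelve. all: by end_near.
Qed.

(** An inductive class, so that stability under derivation follows by induction. Its members are
    total functions; [U] enters only where a denominator must not vanish. *)
Inductive rational_on (E : normedModType R) (U : set E) : (E -> R) -> Prop :=
| rational_cst c : rational_on U (cst c)
| rational_lin (l : {linear E -> R}) of continuous l : rational_on U l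
| rational_add f g of rational_on U f & rational_on U g : rational_on U (f + g)
| rational_mul f g of rational_on U f & rational_on U g : rational_on U (f * g)
| rational_inv f of rational_on U f & (forall x, U x -> f x != 0) :
    rational_on U (fun x => (f x)^-1).

Section Rational.
Context {E : normedModType R} {U : set E}.

Lemma rational_differentiable f x : rational_on U f -> U x -> differentiable f x.
Proof.
move=> + Ux; elim=> [c|l lc|g h _ dg _ dh|g h _ dg _ dh|g _ dg g0].
- exact: differentiable_cst.
- exact: linear_differentiable.
- exact: differentiableD.
- exact: differentiableM.
- by apply: differentiableV => //; apply: g0.
Qed.

(** Sum, Leibniz and quotient rules, one per constructor. They apply at points of [U], where the
    members of the class are differentiable. *)
Lemma rational_derive (v : E) f : rational_on U f ->
  exists2 g, rational_on U g & forall x, U x -> 'D_v f x = g x.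
Proof.
elim=> [c|l lc|g h rg [g' rg' gE] rh [h' rh' hE]
       |g h rg [g' rg' gE] rh [h' rh' hE]|g rg [g' rg' gE] g0].
- by exists (cst 0); [constructor|move=> x _; rewrite derive_cst].
- exists (cst (l v)); first by constructor.
  by move=> x _; rewrite deriveE ?diff_lin//; apply: linear_differentiable.
- exists (g' + h'); first by constructor.
  by move=> x Ux; rewrite deriveD ?gE ?hE//; apply: diff_derivable;
    apply: rational_differentiable.
- exists (g * h' + h * g'); first by do !constructor.
  by move=> x Ux; rewrite deriveM ?gE ?hE//; apply: diff_derivable;
    apply: rational_differentiable.
(* This is -g'/g^2; the class has no constructor for opposites, so the sign is a constant factor. *)
- exists (cst (-1) * ((fun x => (g x)^-1) * (fun x => (g x)^-1)) * g').
    by do !constructor.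
  move=> x Ux; rewrite deriveV ?gE//; [|exact: g0|].
    by rewrite -![RHS]/(-1 * ((g x)^-1 * (g x)^-1) * g' x) mulN1r -exprVn expr2.
  by apply: diff_derivable; apply: rational_differentiable.
Qed.

(** By induction on the directions, the iterated derivative agrees on [U] with some member of the
    class. As [U] is open, they agree near each of its points, so one more derivative can be
    taken. *)
Lemma rational_smooth f g : open U -> rational_on U f ->
  (forall x, U x -> g x = f x) -> smooth_on U g.
Proof.
move=> Uo rf gf s.
suff [f' rf' fE] : exists2 f', rational_on U f' &
    forall x, U x -> foldr (fun v g => 'D_v g) g s x = f' x.
  move=> x Ux; apply: (near_eq_differentiable (g := f')).
    by near=> y; rewrite fE//; near: y; apply: open_nbhs_nbhs.
  exact: rational_differentiable.
elim: s => [|v s [f' rf' fE]] /=; first by exists f.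
have [g' rg' gE] := rational_derive v rf'.
exists g' => // x Ux; rewrite -gE//; apply: near_eq_derive.
by near=> y; rewrite fE//; near: y; apply: open_nbhs_nbhs.
Unshelve. all: by end_near.
Qed.

Lemma rational_sum (I : Type) (r : seq I) (P : pred I) (F : I -> E -> R) :
  (forall i, P i -> rational_on U (F i)) ->
  rational_on U (fun x => \sum_(i <- r | P i) F i x).
Proof.
move=> rF; rewrite (_ : (fun x => _) = \sum_(i <- r | P i) F i).
  by apply: big_ind rF; [exact: rational_cst|exact: rational_add].
by apply/funext => x; rewrite fct_sumE.
Qed.

Lemma rational_prod (I : Type) (r : seq I) (P : pred I) (F : I -> E -> R) :
  (forall i, P i -> rational_on U (F i)) ->
  rational_on U (fun x => \prod_(i <- r | P i) F i x).
Proof.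
move=> rF; rewrite (_ : (fun x => _) = \prod_(i <- r | P i) F i).
  by apply: big_ind rF; [exact: rational_cst|exact: rational_mul].
by apply/funext => x; rewrite fct_prodE.
Qed.

Lemma rational_det m (M : E -> 'M[R]_m) :
  (forall i j, rational_on U (fun x => M x i j)) ->
  rational_on U (fun x => \det (M x)).
Proof.
move=> rM; apply: rational_sum => s _.
rewrite (_ : (fun x => _) =
  cst ((-1) ^+ s) * (fun x => \prod_i M x i (s i)))//.
apply: rational_mul; first exact: rational_cst.
exact: rational_prod.
Qed.

(** Cramer's formula: each entry is a cofactor over the determinant. The adjugate form is used
    because [invmx] returns the matrix itself when it is singular. *)
Lemma rational_invmx m (M : E -> 'M[R]_m) i j :
  (forall k l, rational_on U (fun x => M x k l)) ->
  (forall x, U x -> \det (M x) != 0) ->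
  rational_on U (fun x => ((\det (M x))^-1 *: \adj (M x)) i j).
Proof.
move=> rM M0.
rewrite (_ : (fun x => _) =
  (fun x => (\det (M x))^-1) * (fun x => cofactor (M x) j i)); last first.
  by apply/funext => x; rewrite !mxE.
apply: rational_mul.
  by apply: rational_inv => //; apply: rational_det.
rewrite (_ : (fun x => _) = cst ((-1) ^+ (j + i)) *
  (fun x => \det (row' j (col' i (M x)))))//.
apply: rational_mul; first exact: rational_cst.
apply: rational_det => k l.
by rewrite (_ : (fun x => _) = fun x => M x (lift j k) (lift i l))//;
  apply/funext => x; rewrite !mxE.
Qed.

End Rational.

Lemma smooth_onS (E : normedModType R) (A B : set E) (f : E -> R) :
  A `<=` B -> smooth_on B f -> smooth_on A f.
Proof. by move=> AB sf s x Ax; apply/sf/AB. Qed.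

(** The norm is the l^1 norm of the coordinates in [e], so it bounds each coordinate, and [C] bounds
    [f]. *)
Lemma sym_form_linear_continuous (V : vectType R) (W : normedModType R)
  (f : {linear sym_form V -> W}) : continuous f.
Proof.
apply/linear_bounded_continuous/linear_boundedP.
pose e := vbasis {: sym_form V}; 
  pose C := \sum_(i < \dim {: sym_form V}) `|f e`_i|.
have fC b : `|f b| <= C * `|b|.
  rewrite {1}(coord_vbasis (memvf b)) linear_sum (le_trans (ler_norm_sum _ _ _))//.
  rewrite mulr_suml; apply: ler_sum => i _; rewrite linearZ normrZ mulrC.
  apply: ler_wpM2l => //.
  by rewrite /Num.norm/= /sym_form_norm (bigD1 i)//= lerDl sumr_ge0.
near=> r => b; apply: (le_trans (fC b)); rewrite ler_wpM2r//.
Unshelve. all: by end_near.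
Qed.

End Calculus.

(** * The tensor field in matrix form: change of basis, action of GL(V), smoothness *)

Section Tensor.
Context {R : realType} {V : vectType R}.
Implicit Types b h : sym_form V.

(** Removes both kinds of differential: those of the coordinates [gam] in [Qfield], and that of
    [GL_act g] in the pull-back. *)
Lemma sym_form_diff (W : normedModType R) (f : sym_form V -> W) b :
  linear f -> 'd f b = f :> (sym_form V -> W).
Proof.
move=> lf; pose l := HB.pack f (GRing.isLinear.Build R _ W _ _ lf) :
  {linear sym_form V -> W}.
by rewrite (@diff_lin _ _ _ l)//; apply: sym_form_linear_continuous.
Qed.

Lemma sym_form_sum (I J : finType) b (u : I -> R) (x : I -> V)
    (w : J -> R) (y : J -> V) :
  b (\sum_i u i *: x i) (\sum_j w j *: y j) =
  \sum_i \sum_j u i * w j * b (x i) (y j).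
Proof.
rewrite /sym_form_app linear_sum exchange_big; apply: eq_bigr => j _.
rewrite linearZ linear_sum /= sum_lfunE scaler_sumr; apply: eq_bigr => i _.
by rewrite linearZ scale_lfunE scalerA [w j * _]mulrC.
Qed.

Lemma GL_act_linear (g : 'End(V)) : linear (@GL_act R V g).
Proof.
move=> a b h; apply: sym_formP => x y.
by rewrite sym_formDE sym_formZE !GL_actE sym_formDE sym_formZE.
Qed.

Section Frame.
Context {n : nat} (X : n.-tuple V).

Definition gram b : 'M[R]_n := \matrix_(i, j) gam X i j b.

Lemma gram_sym b : (gram b)^T = gram b.
Proof. by apply/matrixP => i j; rewrite !mxE /gam sym_formC. Qed.

Lemma gam_linear i j : linear (gam X i j).
Proof. by move=> a b h; rewrite /gam sym_formDE sym_formZE. Qed.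

Lemma QfieldE b h h' : Qfield X b h h' =
  \sum_i \sum_j \sum_k \sum_l gam_inv X i k b * gam_inv X j l b *
    (h X`_i X`_j * h' X`_k X`_l).
Proof.
do 4!apply: eq_bigr => ? _.
by rewrite !sym_form_diff//; apply: gam_linear.
Qed.

Lemma Qfield_tr b h h' : Qfield X b h h' =
  \tr (gram h *m invmx (gram b) *m gram h' *m invmx (gram b)).
Proof.
(* With the last inverse transposed, the trace sums h_ji B^ik h'_kl B^jl, where B^ik is
   [gam_inv X i k b]; the symmetry of [h] turns this into the summand of [Qfield]. *)
rewrite -{2}[gram b]gram_sym -trmx_inv.
rewrite QfieldE /mxtrace exchange_big; apply: eq_bigr => j _; rewrite mxE.
under eq_bigr do rewrite exchange_big.
rewrite exchange_big; apply: eq_bigr => l _.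
rewrite exchange_big !mxE mulr_suml; apply: eq_bigr => k _.
rewrite !mxE !mulr_suml; apply: eq_bigr => i _.
by rewrite !mxE /gam /gam_inv/= [h X`_j _]sym_formC; ring.
Qed.

Lemma gram_unit b : basis_of {:V} X -> scalar_product b -> gram b \in unitmx.
Proof.
move=> Xb bs; suff /mulmx1_unit[] : invmx (gram b) *m gram b = 1%:M by [].
apply/matrixP => i j; rewrite !mxE -(gam_invP Xb bs).
by apply: eq_bigr => k _; rewrite !mxE.
Qed.

End Frame.

Lemma gram_change n (X Y : n.-tuple V) b : basis_of {:V} X ->
  let P := \matrix_(i, j) coord X j Y`_i in gram Y b = P *m gram X b *m P^T.
Proof.
move=> Xb P; apply/matrixP => i j; rewrite !mxE /gam.
rewrite {1}(coord_basis Xb (memvf Y`_i)) {1}(coord_basis Xb (memvf Y`_j)).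
rewrite sym_form_sum exchange_big; apply: eq_bigr => l _.
rewrite !mxE mulr_suml; apply: eq_bigr => k _.
by rewrite !mxE /gam; ring.
Qed.

Lemma Qfield_basis n (X Y : n.-tuple V) b : basis_of {:V} X ->
  basis_of {:V} Y -> scalar_product b -> Qfield X b =2 Qfield Y b.
Proof.
move=> Xb Yb bs h h'; rewrite !Qfield_tr !(gram_change Y _ Xb).
set P := \matrix_(i, j) _.
(* The Gram matrix in [Y] is invertible and has [P] and its transpose as factors, so these are
   invertible too. *)
have := gram_unit Yb bs; rewrite (gram_change Y b Xb) -/P !unitmx_mul.
move=> /andP[/andP[Pu Gu] PTu].
have -> : invmx (P *m gram X b *m P^T) =
    invmx P^T *m invmx (gram X b) *m invmx P.
  have : P *m gram X b *m P^T \in unitmx by rewrite !unitmx_mul Pu Gu.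
  move=> u; apply: (can_inj (mulmxK u)); rewrite mulVmx// !mulmxA.
  by rewrite mulmxKV// mulmxKV// mulVmx.
(* The inner transition matrices cancel, leaving a conjugation by [P] under the trace. *)
rewrite !mulmxA !(mulmxK PTu) !(mulmxKV Pu) [RHS]mxtrace_mulC !mulmxA.
by rewrite mulVmx// mul1mx.
Qed.

Lemma gram_GL_act n (X : n.-tuple V) (g : 'End(V)) b :
  gram X (GL_act g b) = gram (map_tuple (g^-1)%VF X) b.
Proof.
by apply/matrixP => i j; rewrite !mxE /gam GL_actE/= !(nth_map 0) ?size_tuple.
Qed.

Lemma Qfield_GL n (X : n.-tuple V) (g : 'End(V)) b : lker g == 0%VS ->
  basis_of {:V} X -> scalar_product b ->
  pullback (GL_act g) (Qfield X) b =2 Qfield X b.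
Proof.
move=> g0 Xb bs h k.
have gi0 : lker (g^-1)%VF == 0%VS.
  apply/lker0P/(can_inj (g := g)) => v.
  by rewrite -comp_lfunE lker0_compfV// id_lfunE.
have gXb : basis_of {:V} (map_tuple (g^-1)%VF X).
  have -> : {:V}%VS = (g^-1 @: {:V})%VS by rewrite lker0_limgf.
  by apply: limg_basis_of => //; rewrite (eqP gi0) capv0.
rewrite /pullback !sym_form_diff; try exact: GL_act_linear.
by rewrite Qfield_tr !gram_GL_act -Qfield_tr (Qfield_basis gXb Xb).
Qed.

Lemma rational_gram n (X : n.-tuple V) (U : set (sym_form V)) i j :
  rational_on U (fun b => gram X b i j).
Proof.
pose l := HB.pack (gam X i j)
  (GRing.isLinear.Build R _ R _ _ (gam_linear X i j)) : {linear sym_form V -> R}.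
rewrite (_ : (fun b => _) = l); last by apply/funext => b; rewrite mxE.
exact/rational_lin/sym_form_linear_continuous.
Qed.

(** The open set on which smoothness is proved; when [X] is a basis it contains every scalar
    product. *)
Lemma open_gram_unit n (X : n.-tuple V) : open [set b | \det (gram X b) != 0].
Proof.
have -> : [set b | \det (gram X b) != 0] =
    (fun b => \det (gram X b)) @^-1` (~` [set 0]).
  by apply/seteqP; split => b /= /eqP.
apply: open_comp => [b _|]; last exact/closed_openC/closed_eq.
apply: differentiable_continuous.
(* The determinant involves no inversion, so it is rational on the whole space. *)
apply: (@rational_differentiable _ _ setT) => //.
by apply: rational_det => i j; apply: rational_gram.
Qed.

Lemma Qfield_smooth n (X : n.-tuple V) h k :
  smooth_on [set b | \det (gram X b) != 0] (fun b => Qfield X b h k).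
Proof.
set U := [set b | _]; pose N b := (\det (gram X b))^-1 *: \adj (gram X b).
pose f b := \sum_i \sum_j \sum_k0 \sum_l
  N b i k0 * N b j l * (h X`_i X`_j * k X`_k0 X`_l).
apply: (@rational_smooth _ _ _ f); [exact: open_gram_unit| |]; last first.
  move=> b Ub; rewrite QfieldE; do 4!apply: eq_bigr => ? _.
  (* On [U] the case distinction in [invmx] selects Cramer's formula. *)
  by rewrite /gam_inv -/(gram X b) /invmx unitmxE unitfE ifT.
have rN i j : rational_on U (fun b => N b i j).
  by apply: rational_invmx => // ? ?; apply: rational_gram.
do 4!(apply: rational_sum => ? _).
apply: (@rational_mul _ _ _ (_ * _) (cst _)); last exact: rational_cst.
exact: rational_mul.
Qed.

End Tensor.

(** * Orthonormal families that separate vectors *)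

Section Orthonormal.
Context {R : realType} {W : vectType R} (B : W -> W -> R).

(** A vector minus its orthogonal expansion is orthogonal to all of [X], hence zero, so [X] spans.
    Pairing a vanishing combination with a member of [X] isolates its coefficient, so [X] is
    free. *)
Lemma orthonormal_basis_separating (X : seq W) :
  (forall y, scalar (B^~ y)) -> uniq X ->
  {in X &, forall x y, x != y -> B x y = 0} ->
  {in X, forall x, B x x = 1 \/ B x x = -1} ->
  (forall h, {in X, forall x, B h x = 0} -> h = 0) ->
  orthonormal_basis B X.
Proof.
move=> Blin Xu Xo X1 Xsep.
pose l y := HB.pack (B^~ y) (GRing.isLinear.Build R W R _ _ (Blin y)) :
  {linear W -> R}.
have BE I (r : seq I) (P : pred I) (u : I -> R) (F : I -> W) y :
    B (\sum_(i <- r | P i) u i *: F i) y = \sum_(i <- r | P i) u i * B (F i) y.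
  rewrite -[LHS]/(l y _) linear_sum; apply: eq_bigr => i _.
  by rewrite linearZ.
have BB x y : x \in X -> y \in X -> B x y = B x x *+ (x == y).
  by move=> xX yX; have [->//|xy] := eqVneq x y; rewrite Xo.
have X2 x : x \in X -> B x x * B x x = 1.
  by move=> /X1[] ->; rewrite ?mulrNN mulr1.
split => //; apply/andP; split.
  apply/eqP/vspaceP => h; rewrite memvf.
  (* The coefficient is B(h,x)/B(x,x); a sign is its own inverse. *)
  suff -> : h = \sum_(x <- X) (B h x * B x x) *: x.
    rewrite big_seq; apply: memv_suml => x xX.
    by apply/memvZ/memv_span.
  apply/subr0_eq/Xsep => y yX.
  rewrite -[LHS]/(l y _) linearB -![l y _]/(B _ y) BE.
  rewrite (bigD1_seq y)//= -mulrA X2// mulr1 big_seq_cond big1 ?addr0 ?subrr//.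
  by move=> x /andP[xX xy]; rewrite (BB x y)// (negPf xy) mulr0.
apply/(freeP (X := in_tuple X)) => k k0 i.
have iX (j : 'I_(size X)) : X`_j \in X by rewrite mem_nth.
have : B (\sum_(j < size X) k j *: X`_j) X`_i * B X`_i X`_i = 0.
  by rewrite k0 -[B 0 _]/(l _ 0) linear0 mul0r.
rewrite BE (bigD1 i)//= big1 => [|j ji].
  by rewrite addr0 -mulrA X2// mulr1.
by rewrite BB// nth_uniq// (negPf ji : (j == i :> nat) = false) mulr0.
Qed.

End Orthonormal.

(** The triangle and its mirror image cover the square, with the diagonal covered twice. *)
Lemma sum_triangle n (f : 'I_n -> 'I_n -> nat) : (forall i j, f i j = f j i) ->
  (2 * (\sum_(ij : 'I_n * 'I_n | ij.1 <= ij.2) f ij.1 ij.2) =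
   \sum_i \sum_j f i j + \sum_i f i i)%N.
Proof.
move=> fC; pose g (i j : 'I_n) := ((i <= j)%N * f i j)%N.
have -> : (\sum_(ij : 'I_n * 'I_n | ij.1 <= ij.2) f ij.1 ij.2 =
    \sum_i \sum_j g i j)%N.
  rewrite pair_big /= [LHS]big_mkcond; apply: eq_bigr => -[i j] _ /=.
  by rewrite /g; case: leqP; rewrite ?mul1n ?mul0n.
rewrite mul2n -addnn {2}exchange_big -!big_split; apply: eq_bigr => i _ /=.
rewrite -!big_split/= (bigD1 i)//= [in RHS](bigD1 i)//= [RHS]addnAC.
congr (_ + _)%N; first by rewrite /g leqnn mul1n.
apply: eq_bigr => j ji; rewrite /g [f j i]fC -mulnDl.
by rewrite -[RHS]mul1n; congr (_ * _)%N; move: ji; rewrite -val_eqE /=; case: ltngtP.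
Qed.

(** * An orthonormal basis for Q_b and the count of its signs *)

Section Signature.
Context {R : realType} {V : vectType R} {n : nat} (Y : n.-tuple V).
Context (b : sym_form V).
Context (Yb : orthonormal_basis b Y).
Implicit Types h : sym_form V.

Let eps (i : 'I_n) : R := b Y`_i Y`_i.

Let basisY : basis_of {:V} Y. Proof. by case: Yb. Qed.

Let epsP i : eps i = 1 \/ eps i = -1.
Proof. by case: Yb => _ _; apply; rewrite mem_nth ?size_tuple. Qed.

Let eps2 i : eps i * eps i = 1.
Proof. by case: (epsP i) => ->; rewrite ?mulrNN mulr1. Qed.

Let gramY : gram Y b = diag_mx (\row_i eps i).
Proof.
apply/matrixP => i j; rewrite !mxE /gam; have [->//|ij] := eqVneq i j.
case: Yb => _ Yo _; rewrite mulr0n Yo ?mem_nth ?size_tuple//.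
by rewrite nth_uniq ?size_tuple// (free_uniq (basis_free basisY)).
Qed.

Let gam_invY i k : gam_inv Y i k b = eps i *+ (i == k).
Proof.
rewrite /gam_inv -/(gram Y b).
(* A diagonal matrix of signs is its own inverse. *)
have GG : gram Y b *m gram Y b = 1%:M.
  rewrite gramY mulmx_diag -diag_const_mx; congr diag_mx.
  by apply/rowP => j; rewrite !mxE eps2.
have Gu : gram Y b \in unitmx by case/mulmx1_unit: GG.
by rewrite -[invmx _]mulmx1 -GG mulKmx// gramY !mxE.
Qed.

Lemma Qfield_orthonormal h h' : Qfield Y b h h' =
  \sum_i \sum_j eps i * eps j * (h Y`_i Y`_j * h' Y`_i Y`_j).
Proof.
rewrite QfieldE; apply: eq_bigr => i _; apply: eq_bigr => j _.
rewrite (bigD1 i)//= [X in _ + X]big1 ?addr0 => [|k ki]; last first.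
  by apply: big1 => l _; rewrite gam_invY eq_sym (negPf ki) mulr0n !mul0r.
rewrite (bigD1 j)//= big1 ?addr0 => [|l lj]; last first.
  by rewrite [gam_inv Y j l b]gam_invY eq_sym (negPf lj) mulr0n mulr0 mul0r.
by rewrite !gam_invY !eqxx.
Qed.

Lemma Qfield_sym h h' : Qfield Y b h h' = Qfield Y b h' h.
Proof.
rewrite !Qfield_orthonormal; apply: eq_bigr => i _; apply: eq_bigr => j _.
by rewrite [h _ _ * _]mulrC.
Qed.

Lemma Qfield_scalar h : scalar (Qfield Y b h).
Proof.
move=> a k l; rewrite !Qfield_orthonormal mulr_sumr -big_split.
apply: eq_bigr => i _; rewrite /= mulr_sumr -big_split; apply: eq_bigr => j _ /=.
by rewrite sym_formDE sym_formZE; ring.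
Qed.

(* The weights make these forms orthonormal up to sign: the square of e_ij    *)
(* gets two equal contributions, from (i, j) and (j, i), when i != j.         *)
Let c (i j : 'I_n) : R := if i == j then 2^-1 else (Num.sqrt 2)^-1.

(** For i = j the two summands coincide and the weight 1/2 makes the (i, i) entry 1; otherwise the
    (i, j) and (j, i) entries are both 1/sqrt 2. *)
Let e (i j : 'I_n) : sym_form V := mk_sym_form (fun v w =>
  c i j * (coord Y i v * coord Y j w + coord Y j v * coord Y i w)).

Let eE (i j k l : 'I_n) :
  e i j Y`_k Y`_l = c i j * ((i == k)%:R * (j == l)%:R + (j == k)%:R * (i == l)%:R).
Proof.
rewrite mk_sym_formE => [|x a u v|x y]; last by ring.
  rewrite !coord_free ?(basis_free basisY)//.
  by rewrite [k == i]eq_sym [l == j]eq_sym [k == j]eq_sym [l == i]eq_sym.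
have cP m : coord Y m (a *: u + v) = a * coord Y m u + coord Y m v.
  exact: linearP.
by rewrite -[RHS]/(a * _ + _) !cP; ring.
Qed.

Let sum_delta (F : 'I_n -> R) i : \sum_j F j * (i == j)%:R = F i.
Proof.
rewrite (bigD1 i)//= eqxx mulr1 big1 ?addr0// => j ji.
by rewrite eq_sym (negPf ji) mulr0.
Qed.

(** Pairing with [e i j] isolates one coordinate of [h]; the 2 comes from the two equal
    contributions of its symmetric summands. *)
Let Qe h (i j : 'I_n) : Qfield Y b h (e i j) = 2 * c i j * eps i * eps j * h Y`_i Y`_j.
Proof.
rewrite Qfield_orthonormal.
under eq_bigr => k _. under eq_bigr => l _.
  rewrite eE (_ : _ * _ =
    c i j * eps k * eps l * h Y`_k Y`_l * (i == k)%:R * (j == l)%:R +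
    c i j * eps k * eps l * h Y`_k Y`_l * (j == k)%:R * (i == l)%:R); last by ring.
  over.
rewrite big_split !sum_delta /=. over.
rewrite big_split !sum_delta/= [h Y`_j _]sym_formC; ring.
Qed.

Let c_neq0 i j : c i j != 0.
Proof. by rewrite /c; case: ifP => _; rewrite invr_eq0 ?sqrtr_eq0 ?pnatr_eq0 -?ltNge. Qed.

Let eps_neq0 i : eps i != 0.
Proof. by case: (epsP i) => ->; rewrite ?oppr_eq0 oner_eq0. Qed.

Let Qee (i j k l : 'I_n) : (i <= j)%N -> (k <= l)%N ->
  Qfield Y b (e i j) (e k l) = eps i * eps j *+ ((i, j) == (k, l)).
Proof.
move=> ij kl; rewrite Qe eE xpair_eqE.
have [ik|ik] := eqVneq i k; have [jl|jl] := eqVneq j l => /=; last first.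
(* A nonzero value would need j = k and i = l; then i <= j = k <= l = i forces i = k. *)
- have [jk|jk] := eqVneq j k; rewrite ?mul0r ?addr0 ?mulr0//.
  have [il|il] := eqVneq i l; rewrite ?mulr0 ?addr0 ?mulr0//.
  by case/negP: ik; rewrite -val_eqE eqn_leq /= -{1}jk ij /= il.
- have [jk|jk] := eqVneq j k; rewrite ?mul0r ?addr0 ?mulr0//.
  have [il|il] := eqVneq i l; rewrite ?mulr0 ?addr0 ?mulr0//.
  by case/negP: ik; rewrite il -jl jk.
- have [jk|jk] := eqVneq j k; rewrite ?mul0r ?addr0 ?mulr0//.
  have [il|il] := eqVneq i l; rewrite ?mulr0 ?addr0 ?mulr0//.
  by case/negP: jl; rewrite jk -ik il.
subst k l; rewrite /c; have [<-|ij'] := eqVneq i j.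
  by rewrite !mulr1 -[_ * _ * eps i]mulrA eps2; field.
rewrite mulr0 addr0 !mulr1 mulr1n.
(* Off the diagonal the square of [e i j] is 2 c^2 eps_i eps_j, with c = 1/sqrt 2. *)
have s2 : (Num.sqrt 2)^-1 * (Num.sqrt 2)^-1 = 2^-1 :> R.
  by rewrite -invfM -expr2 sqr_sqrtr.
transitivity (2 * ((Num.sqrt 2)^-1 * (Num.sqrt 2)^-1) * eps i * eps j); first by ring.
by rewrite s2; field.
Qed.

(** As [e i j] and [e j i] coincide, the pairs with i <= j list each form once. *)
Let P := [pred ij : 'I_n * 'I_n | (ij.1 <= ij.2)%N].
Let E := [seq e ij.1 ij.2 | ij <- enum P].

Let memP ij : ij \in enum P -> (ij.1 <= ij.2)%N.
Proof. by rewrite mem_enum. Qed.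

(** By [Qe] the pairings are nonzero multiples of the h_ij with i <= j, and symmetry gives the
    others. This yields both the non-degeneracy of Q_b and the spanning property of [E]. *)
Let E_sep h : {in E, forall x, Qfield Y b h x = 0} -> h = 0.
Proof.
move=> hE.
have h0 (i j : 'I_n) : (i <= j)%N -> h Y`_i Y`_j = 0.
  move=> ij; have /hE/eqP : e i j \in E.
    by apply/mapP; exists (i, j); rewrite ?mem_enum.
  by rewrite Qe !mulf_eq0 !(negPf (eps_neq0 _)) (negPf (c_neq0 _ _)) pnatr_eq0 /= => /eqP.
apply: sym_formP => x y.
rewrite (coord_basis basisY (memvf x)) (coord_basis basisY (memvf y)).
rewrite !sym_form_sum; apply: eq_bigr => i _; apply: eq_bigr => j _.
have -> : (0 : sym_form V) Y`_i Y`_j = 0.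
  by have := sym_formZE 0 (0 : sym_form V) Y`_i Y`_j; rewrite scale0r mul0r.
by case/orP: (leq_total i j) => ?; [|rewrite sym_formC]; rewrite h0.
Qed.

Lemma Qfield_scalar_product : scalar_product (Qfield Y b).
Proof.
split; [exact: Qfield_scalar|exact: Qfield_sym|].
by move=> h h0; apply: E_sep => x _; apply: h0.
Qed.

Let eps_eq i j : (eps i * eps j == 1) = ((eps i == 1) == (eps j == 1)).
Proof.
have N : (-1 == 1 :> R) = false by rewrite eqNr oner_eq0.
by case: (epsP i) => ->; case: (epsP j) => ->; rewrite ?mulrNN ?mulr1 ?mul1r ?eqxx ?N ?eqxx.
Qed.

Let eps_eqN i j : (eps i * eps j == -1) = ((eps i == 1) != (eps j == 1)).
Proof.
have N : (-1 == 1 :> R) = false by rewrite eqNr oner_eq0.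
have N' : (1 == -1 :> R) = false by rewrite eq_sym.
by case: (epsP i) => ->; case: (epsP j) => ->;
  rewrite ?mulrNN ?mulr1 ?mul1r ?eqxx ?N ?N' ?eqxx.
Qed.

Let Qe1 (ij : 'I_n * 'I_n) : P ij ->
  Qfield Y b (e ij.1 ij.2) (e ij.1 ij.2) = eps ij.1 * eps ij.2.
Proof. by move=> /= ?; rewrite Qee// eqxx. Qed.

Let E_orthonormal : orthonormal_basis (Qfield Y b) E.
Proof.
have epsM i j : eps i * eps j = 1 \/ eps i * eps j = -1.
  by case: (epsP i) => ->; case: (epsP j) => ->; rewrite ?mulrNN ?mulr1 ?mul1r; tauto.
have Qe0 (ij kl : 'I_n * 'I_n) : P ij -> P kl -> ij != kl ->
    Qfield Y b (e ij.1 ij.2) (e kl.1 kl.2) = 0.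
  by case: ij kl => [i j] [k l] /= ij kl /negPf N; rewrite Qee// N.
apply: orthonormal_basis_separating => //.
- by move=> h a k l; rewrite ![Qfield Y b _ h]Qfield_sym Qfield_scalar.
(* If two distinct pairs gave the same form, it would be orthogonal to itself, while its square is a
   sign. *)
- rewrite map_inj_in_uniq ?enum_uniq// => ij kl /memP Pij /memP Pkl eq_e.
  apply/eqP/negPn/negP => N; have := Qe0 _ _ Pij Pkl N.
  rewrite -eq_e Qe1// => /eqP.
  by rewrite mulf_eq0 !(negPf (eps_neq0 _)).
- move=> _ _ /mapP[ij /memP Pij ->] /mapP[kl /memP Pkl ->] N.
  by apply: Qe0 => //; apply: contraNneq N => ->.
- by move=> _ /mapP[ij /memP Pij ->]; rewrite Qe1.
Qed.

(** The count runs over the triangle i <= j; doubling it gives access to [sum_triangle] without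
    dividing naturals. *)
Let count_E (a : R) (f : 'I_n -> 'I_n -> bool) :
  (forall i j, (eps i * eps j == a) = f i j) -> (forall i j, f i j = f j i) ->
  (2 * count (fun x => Qfield Y b x x == a) E =
   \sum_i \sum_j f i j + \sum_i f i i)%N.
Proof.
move=> fE fC; rewrite -(sum_triangle (f := fun i j => f i j)); last first.
  by move=> i j; rewrite fC.
congr (2 * _)%N; rewrite count_map -sum1_count big_mkcond big_enum /=.
rewrite big_mkcond [RHS]big_mkcond; apply: eq_bigr => ij _.
by rewrite inE; case: ifP => // Pij; rewrite Qe1// fE; case: (f _ _).
Qed.

Let count_Y (a : pred V) : count a Y = (\sum_(i < n) a (Y`_i)%R)%N.
Proof.
rewrite -sum1_count big_mkcond big_tuple; apply: eq_bigr => i _.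
by rewrite (tnth_nth 0); case: (a _).
Qed.

(** Among ordered pairs (i, j), p^2 + p'^2 have equal signs and 2pp' opposite ones; the diagonal
    adds p + p' to the former and nothing to the latter. Halving gives the signature. *)
Lemma Qfield_signature p p' :
  count (fun x => b x x == 1) Y = p -> count (fun x => b x x == -1) Y = p' ->
  has_signature (Qfield Y b)
    ((p * (p + 1) + p' * (p' + 1)) %/ 2)%N (p * p')%N.
Proof.
pose s i : bool := eps i == 1.
have sN i : (eps i == -1) = ~~ s i.
  have N : (-1 == 1 :> R) = false by rewrite eqNr oner_eq0.
  have N' : (1 == -1 :> R) = false by rewrite eq_sym.
  by rewrite /s; case: (epsP i) => ->; rewrite ?eqxx ?N ?N'.
rewrite !count_Y => pE p'E.
have {}pE : (\sum_i s i = p)%N by [].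
have {}p'E : (\sum_i ~~ s i = p')%N.
  by rewrite -p'E; apply: eq_bigr => i _; rewrite -sN.
have nE : (\sum_i (s i == s i) = p + p')%N.
  rewrite -pE -p'E -big_split; apply: eq_bigr => i _ /=.
  by rewrite eqxx; case: (s i).
have n0 : (\sum_i (s i != s i) = 0)%N by apply: big1 => i _; rewrite eqxx.
have sq : (\sum_i \sum_j (s i == s j) = p * p + p' * p')%N.
  rewrite -pE -p'E !big_distrlr -big_split; apply: eq_bigr => i _ /=.
  by rewrite -big_split; apply: eq_bigr => j _ /=; do 2!case: (s _).
have sqN : (\sum_i \sum_j (s i != s j) = 2 * (p * p'))%N.
  rewrite mul2n -addnn [in X in (_ + X)%N]mulnC -pE -p'E !big_distrlr -big_split.
  apply: eq_bigr => i _ /=.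
  by rewrite -big_split; apply: eq_bigr => j _ /=; do 2!case: (s _).
have C1 := @count_E 1 (fun i j => s i == s j) eps_eq (fun i j => eq_sym _ _).
have CN := @count_E (-1) (fun i j => s i != s j) eps_eqN
  (fun i j => congr1 negb (eq_sym _ _)).
rewrite sq nE in C1; rewrite sqN n0 addn0 in CN.
have -> : (p * (p + 1) + p' * (p' + 1) = p * p + p' * p' + (p + p'))%N by lia.
(* The numerator is twice a count, so the integer division is exact. *)
rewrite -C1 mulKn//; exists E; split => //.
by apply/eqP; rewrite -(eqn_pmul2l (isT : 0 < 2)%N) CN.
Qed.

End Signature.

Theorem mainTheorem5 (R : realType) (V : vectType R) (n p p' : nat)
    (n_gt0 : (0 < n)%N) (dimV : \dim {:V} = n) (ppn : (p + p' = n)%N) :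
  (forall X Y : n.-tuple V, basis_of {:V} X -> basis_of {:V} Y ->
     forall b : sym_form V, scalar_products p p' b ->
       Qfield X b =2 Qfield Y b)
  /\ (forall X : n.-tuple V, basis_of {:V} X ->
     [/\ metric_on (scalar_products p p') (Qfield X),
         (forall b : sym_form V, scalar_products p p' b ->
            has_signature (Qfield X b)
              ((p * (p + 1) + p' * (p' + 1)) %/ 2)%N (p * p')%N)
       & (forall g : 'End(V), lker g == 0%VS ->
            forall b : sym_form V, scalar_products p p' b ->
              pullback (GL_act g) (Qfield X) b =2 Qfield X b)]).
Proof.
split=> [X Y Xb Yb b [bs _]|X Xb]; first exact: Qfield_basis.
(* By independence of the basis, algebraic claims at [b] may be checked in a basis orthonormal for
   [b]. *)
have orthonormal b : scalar_products p p' b -> exists Y : n.-tuple V,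
    [/\ Qfield X b = Qfield Y b, orthonormal_basis b Y,
        count (fun x => b x x == 1) Y = p & count (fun x => b x x == -1) Y = p'].
  case=> bs [Y [Yo Yp Yp']]; have [Yb _ _] := Yo.
  have sY : size Y == n by rewrite -dimV (size_basis (X := in_tuple Y) Yb).
  exists (Tuple sY); split => //.
  by apply/funext => h; apply/funext => k; apply: Qfield_basis.
split=> [|b /orthonormal[Y [-> Yo Yp Yp']]|g g0 b [bs _]].
- split=> [h k|b /orthonormal[Y [-> Yo _ _]]]; last exact: Qfield_scalar_product.
  (* Smoothness is proved in the fixed basis [X], since an orthonormal basis varies with [b]. *)
  apply: (smooth_onS _ (@Qfield_smooth _ _ _ X h k)) => b [bs _] /=.
  by rewrite -unitfE -unitmxE gram_unit.
- exact: Qfield_signature.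
- exact: Qfield_GL.
Qed.
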